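(* There exists a countable commutative group $G$ such that $\mathfrak{Z}_{n}(G)$ is properly contained in $\mathfrak{Z}_{m}(G)$ for all non-negative integers $n<m$. In particular, for all $n\in\mathbb{N}$ we have $$\mathfrak{Z}(G)=\mathfrak{Z}^{\pm}(G)\neq \mathfrak{Z}^{\pm}_{n}(G)=\mathfrak{Z}_{n}(G).$$
   Context: $\mathbb{N}=\{0,1,2,\ldots\}$. Functions are written on the right of their arguments. Let $G$ be a group. A function $f:G\to G$ is a group polynomial of degree $n$ if $(x)f=a_0x^{\varepsilon_1}a_1\cdots x^{\varepsilon_n}a_n$ for some $a_0,\ldots,a_n\in G$ and $\varepsilon_1,\ldots,\varepsilon_n\in\{-1,1\}$; constant functions are group polynomials of degree $0$. The group Zariski topology $\mathfrak{Z}^{\pm}(G)$ is the topology on $G$ generated (as a subbase) by the sets $\{x\in G:(x)f\neq 1_G\}$, where $f$ is a group polynomial. For $n\in\mathbb{N}$, $\mathfrak{Z}^{\pm}_n(G)$ is the topology generated by the sets $\{x\in G:(x)f\neq 1_G\}$, where $f$ is a group polynomial of degree at most $n$. Let $S$ be a semigroup, and let $S^1=S$ if $S$ has an identity, $S^1=S\cup\{1\}$ (identity adjoined) otherwise. A function $f:S\to S$ is a semigroup polynomial of degree $n$ if $(x)f=a_0xa_1\cdots xa_n$ for some $a_0,\ldots,a_n\in S^1$; constant functions are semigroup polynomials of degree $0$. The semigroup Zariski topology $\mathfrak{Z}(S)$ is the topology on $S$ generated (as a subbase) by the sets $\{x\in S:(x)f\neq (x)g\}$, where $f,g$ are semigroup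 polynomials. For $n\in\mathbb{N}$, $\mathfrak{Z}_n(S)$ is the topology generated by the sets $\{x\in S:(x)f\neq (x)g\}$, where $f,g$ are semigroup polynomials of degree at most $n$. *)

(* Defs.v *)
From HB Require Import structures.
From mathcomp Require Import all_boot.
From mathcomp Require Import boolp classical_sets functions cardinality.
From mathcomp Require Import topology_structure.

Set Implicit Arguments.
Unset Strict Implicit.
Unset Printing Implicit Defensive.

Local Open Scope classical_set_scope.
Local Open Scope group_scope.

(* A topology on T is handled as its set of open sets, so that several
   topologies on one carrier can be compared by equality and inclusion. *)
Definition subbase_space (T : choiceType) (B : set (set T)) : Type := T.

HB.instance Definition _ (T : choiceType) (B : set (set T)) :=
  Choice.on (subbase_space B).
HB.instance Definition _ (T : choiceType) (B : set (set T)) :=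
  isSubBaseTopological.Build (subbase_space B) B id.

Definition generated_topology (T : choiceType) (B : set (set T)) :
    set (set T) :=
  @open (subbase_space B).

Section GroupZariski.
Variable G : groupType.

(* [eps i = true] stands for the exponent -1. *)
Definition is_group_polynomial (n : nat) (f : G -> G) : Prop :=
  exists (a : 'I_n.+1 -> G) (eps : 'I_n -> bool), forall x : G,
    f x = a ord0 *
      \prod_(i < n) ((if eps i then x^-1 else x) * a (lift ord0 i)).

Definition group_zariski : set (set G) :=
  generated_topology
    [set A | exists (k : nat) (f : G -> G),
      is_group_polynomial k f /\ A = [set x | f x <> 1]].

Definition group_zariski_n (n : nat) : set (set G) :=
  generated_topology
    [set A | exists (k : nat) (f : G -> G),
      [/\ (k <= n)%N, is_group_polynomial k f & A = [set x | f x <> 1]]].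

End GroupZariski.

Arguments group_zariski : clear implicits.
Arguments group_zariski_n : clear implicits.

(* S with a new identity [None] adjoined unconditionally; S^1 is the subset
   [S1] below, which leaves [None] out when S already has an identity. *)
Definition adjoin1 (S : semigroupType) : Type := option S.

Section Adjoin1.
Variable S : semigroupType.

HB.instance Definition _ := Choice.on (adjoin1 S).

Definition adjoin1_mul (u v : adjoin1 S) : adjoin1 S :=
  match u, v with
  | Some a, Some b => Some (a * b)
  | None, _ => v
  | _, None => u
  end.

Fact adjoin1_mulA : associative adjoin1_mul.
Proof. by case=> [a|] [b|] [c|] //=; rewrite mulgA. Qed.

Fact adjoin1_mul1 : left_id (None : adjoin1 S) adjoin1_mul.
Proof. by case. Qed.

Fact adjoin1_mulr1 : right_id (None : adjoin1 S) adjoin1_mul.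
Proof. by case. Qed.

HB.instance Definition _ :=
  isMonoid.Build (adjoin1 S) adjoin1_mulA adjoin1_mul1 adjoin1_mulr1.

End Adjoin1.

Section SemigroupZariski.
Variable S : semigroupType.

Definition has_identity : Prop :=
  exists e : S, left_id e *%g /\ right_id e *%g.

Definition S1 : set (adjoin1 S) := [set u | u = None -> ~ has_identity].

Definition is_semigroup_polynomial (n : nat) (f : S -> S) : Prop :=
  exists2 a : 'I_n.+1 -> adjoin1 S, (forall i, S1 (a i)) &
    forall x : S,
      (Some (f x) : adjoin1 S) = a ord0 *
        \prod_(i < n) ((Some x : adjoin1 S) * a (lift ord0 i)).

Definition semigroup_zariski : set (set S) :=
  generated_topology
    [set A | exists (k l : nat) (f g : S -> S),
      [/\ is_semigroup_polynomial k f, is_semigroup_polynomial l g &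
          A = [set x | f x <> g x]]].

Definition semigroup_zariski_n (n : nat) : set (set S) :=
  generated_topology
    [set A | exists (k l : nat) (f g : S -> S),
      [/\ (k <= n)%N /\ (l <= n)%N, is_semigroup_polynomial k f,
          is_semigroup_polynomial l g & A = [set x | f x <> g x]]].

End SemigroupZariski.

Arguments has_identity : clear implicits.
Arguments S1 : clear implicits.
Arguments semigroup_zariski : clear implicits.
Arguments semigroup_zariski_n : clear implicits.

(* Main.v *)
Require Import Defs.
From HB Require Import structures.
From mathcomp Require Import all_boot all_algebra finmap.
From mathcomp Require Import boolp classical_sets functions cardinality.
From mathcomp Require Import topology_structure.

(** The group is a direct sum of countably many copies of Q/Z, realised as the
    quotient of the additive group of rational polynomials by the integral
    ones.

    In a commutative group every polynomial is a monomial c x^k, with k an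
    integer for group polynomials and a natural number for semigroup ones.
    After cancellation, the sets generating either Zariski topology of level n
    are therefore exactly the sets {x | x^k <> c} with k <= n
    ([group_inequationsE], [semigroup_inequationsE]).  So the group and
    semigroup topologies agree at every level, and in the limit.

    To separate level n from level n+1, let s_i be the class of X^i/(n+1).
    Each s_i is killed by n+1, while for 0 < k <= n the powers s_i^k are
    pairwise distinct, so that an equation x^k = c has at most one solution
    among the s_i.  Hence a nonempty set that is open at level n contains s_i
    for all large i ([eventually_in_open]).  But {x | x^(n+1) <> 1}, which is
    open at level n+1, is nonempty because the group has unbounded exponent,
    and contains no s_i. *)

Set Implicit Arguments.
Unset Strict Implicit.
Unset Printing Implicit Defensive.

Import GRing.Theory Num.Theory.

Local Open Scope classical_set_scope.
Local Open Scope group_scope.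

(** * Topologies generated by a subbase *)

Lemma subbase_sub_generated_topology (T : choiceType) (B : set (set T)) :
  B `<=` generated_topology B.
Proof.
move=> A BA; exists [set A]; last by rewrite bigcup_set1.
move=> _ ->.
exists [fset A]%fset; last by rewrite set_fset1 bigcap_set1.
by move=> C; rewrite in_fset1 => /eqP ->; rewrite inE.
Qed.

(** Serves as an induction principle: a property of sets that holds on the
    subbase and is stable under the topological operations holds on every
    open set. *)
Lemma generated_topology_min (T : choiceType) (B O : set (set T)) :
    O setT -> (forall U V, O U -> O V -> O (U `&` V)) ->
    (forall F : set (set T), F `<=` O -> O (\bigcup_(U in F) U)) ->
  B `<=` O -> generated_topology B `<=` O.
Proof.
move=> OT OI OU BO _ [F Fsub <-]; apply: OU => U /Fsub[D DB <-].
rewrite bigcap_fset big_seq; elim/big_ind: _ => // V VD.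
by apply/BO; have := DB _ VD; rewrite inE.
Qed.

Lemma generated_topologyS (T : choiceType) (B C : set (set T)) :
  B `<=` C -> generated_topology B `<=` generated_topology C.
Proof.
move=> BC; apply: generated_topology_min.
- exact: (@openT (subbase_space C)).
- exact: (@openI (subbase_space C)).
- by move=> F FO; exact: (@bigcup_open (subbase_space C)).
- by move=> U /BC; apply: subbase_sub_generated_topology.
Qed.

(** * The topologies generated by power inequations *)

Section PowerInequations.
Variable G : groupType.

Definition power_inequations (n : nat) : set (set G) :=
  [set A | exists (k : nat) (c : G), (k <= n)%N /\ A = [set x | x ^+ k <> c]].

Lemma power_inequationsS m n :
  (m <= n)%N -> power_inequations m `<=` power_inequations n.
Proof.
by move=> mn _ [k [c [km ->]]]; exists k, c; split=> //; apply: leq_trans mn.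
Qed.

(** Cancelling the smaller of the two powers of x leaves a single power, whose
    exponent is the difference p - q or q - p. *)
Lemma two_sided_power_inequation (c d : G) p q n :
    (p <= n)%N -> (q <= n)%N ->
  power_inequations n [set x | c * x ^+ p <> d * x ^+ q].
Proof.
wlog le_qp : c d p q / (q <= p)%N.
  move=> Hw pn qn; have [qp|/ltnW pq] := leqP q p; first exact: Hw.
  have -> : [set x | c * x ^+ p <> d * x ^+ q] =
            [set x | d * x ^+ q <> c * x ^+ p].
    by apply/seteqP; split=> x /= /[swap] ->.
  exact: Hw.
move=> pn _; exists (p - q)%N, (c^-1 * d).
split; first exact: leq_trans (leq_subr _ _) pn.
apply/seteqP; split=> x /=; apply: contra_not.
  by move=> E; rewrite -(subnK le_qp) expgnDr mulgA E mulgA mulgV mul1g.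
move=> E; apply/(mulgI c)/(mulIg (x ^+ q)).
by rewrite mulVKg -mulgA -expgnDr subnK.
Qed.

(** Each subbasic set misses at most one term of the sequence, unless it is
    empty; being either empty or eventually containing the sequence is stable
    under unions and binary intersections. *)
Lemma eventually_in_open (n : nat) (s : nat -> G) (U : set G) :
    (forall k, (0 < k <= n)%N -> injective (fun i => s i ^+ k)) ->
    generated_topology (power_inequations n) U -> U !=set0 ->
  exists N, forall i, (N <= i)%N -> U (s i).
Proof.
move=> s_inj; move: U; apply: generated_topology_min.
- by exists 0%N.
- move=> U V IHU IHV [x [Ux Vx]].
  have [M UM] := IHU (ex_intro _ x Ux).
  have [N VN] := IHV (ex_intro _ x Vx).
  exists (maxn M N) => i; rewrite geq_max => /andP[Mi Ni].
  by split; [apply: UM | apply: VN].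
- move=> F FU [x [U FU' Ux]].
  have [N UN] := FU U FU' (ex_intro _ x Ux).
  by exists N => i Ni; exists U => //; apply: UN.
(* the inequation 1 <> c, of exponent 0, is satisfied everywhere or nowhere *)
move=> _ [[|k] [c [kn ->]]] [x xc]; first by exists 0%N.
have [[i0 si0]|no_sol] := pselect (exists i, s i ^+ k.+1 = c); last first.
  by exists 0%N => i _ E; apply: no_sol; exists i.
exists i0.+1 => i lt_i0i E.
have := s_inj k.+1 kn i i0; rewrite E si0 => /(_ erefl) ii0.
by rewrite ii0 ltnn in lt_i0i.
Qed.

(** The set of x with x ^+ n.+1 <> 1 separates the two topologies, since it
    avoids the whole sequence s. *)
Lemma generated_topology_power_proper (n : nat) (s : nat -> G) :
    (forall i, s i ^+ n.+1 = 1) ->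
    (forall k, (0 < k <= n)%N -> injective (fun i => s i ^+ k)) ->
    (exists x : G, x ^+ n.+1 <> 1) ->
  generated_topology (power_inequations n) `<`
  generated_topology (power_inequations n.+1).
Proof.
move=> s_tors s_inj nexp; split.
  exact/generated_topologyS/power_inequationsS.
move=> /(_ [set x | x ^+ n.+1 <> 1]) sub.
have [|N sN] := eventually_in_open s_inj (sub _) nexp.
  by apply: subbase_sub_generated_topology; exists n.+1, 1.
exact: (sN N (leqnn N)).
Qed.

(** * Zariski topologies of a commutative group *)

Section Commutative.
Hypothesis mulC : forall x y : G, x * y = y * x.

Lemma semigroup_polynomial_normal_form n (f : G -> G) :
  is_semigroup_polynomial n f -> exists c : G, forall x, f x = c * x ^+ n.
Proof.
move=> [a aS1 fE].
(* the adjoined identity is excluded, as G already has one *)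
have has1 : has_identity G by exists 1; split=> x; rewrite ?mul1g ?mulg1.
have aE i : exists c : G, a i = Some c.
  by case E: (a i) => [c|]; [exists c | case: (aS1 i E)].
have [b bE] := choice aE.
suff prodE m (b0 : G) (d : 'I_m -> G) : exists c : G, forall x : G,
    (Some b0 : adjoin1 G) *
      \prod_(i < m) ((Some x : adjoin1 G) * (Some (d i) : adjoin1 G))
    = Some (c * x ^+ m).
  have [c cE] := prodE n (b ord0) (fun i => b (lift ord0 i)).
  exists c => x; apply: Some_inj; rewrite fE bE -cE.
  by congr adjoin1_mul; apply: eq_bigr => i _; rewrite bE.
elim: m d => [|m IHm] d.
  by exists b0 => x; rewrite big_ord0 expg0 !mulg1.
have [c cE] := IHm (fun i => d (widen_ord (leqnSn m) i)).
exists (c * d ord_max) => x.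
rewrite big_ord_recr mulgA cE; congr Some.
by rewrite expgSr -!mulgA; congr (c * _); rewrite mulgA mulC.
Qed.

(** Here p counts the factors x and q the factors x^-1, and the latter are
    moved to the left-hand side so that only natural exponents occur. *)
Lemma group_polynomial_normal_form n (f : G -> G) :
    is_group_polynomial n f ->
  exists (c : G) (p q : nat),
    (p + q)%N = n /\ forall x, f x * x ^+ q = c * x ^+ p.
Proof.
move=> [a [eps fE]].
suff prodE m (e : 'I_m -> bool) (b : 'I_m -> G) : exists (c : G) (p q : nat),
    (p + q)%N = m /\ forall x,
    \prod_(i < m) ((if e i then x^-1 else x) * b i) * x ^+ q = c * x ^+ p.
  have [c [p [q [pq cE]]]] := prodE n eps (fun i => a (lift ord0 i)).
  by exists (a ord0 * c), p, q; split=> // x; rewrite fE -!mulgA cE.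
elim: m e b => [|m IHm] e b.
  by exists 1, 0%N, 0%N; split=> // x; rewrite big_ord0 !expg0.
pose w i := widen_ord (leqnSn m) i.
have [c [p [q [pq IH]]]] := IHm (fun i => e (w i)) (fun i => b (w i)).
exists (c * b ord_max).
case E: (e ord_max); [exists p, q.+1 | exists p.+1, q];
    (split=> [|x]; first by rewrite ?addnS ?addSn pq);
    rewrite big_ord_recr /= E.
  rewrite -mulgA (mulC x^-1) -mulgA expgS mulKg (mulC (b _)) mulgA IH.
  by rewrite -mulgA (mulC (x ^+ p)) mulgA.
rewrite -mulgA (mulC _ (x ^+ q)) mulgA IH expgSr -!mulgA.
by congr (c * _); rewrite mulgA mulC.
Qed.

Lemma group_inequationsE n :
  [set A | exists (k : nat) (f : G -> G),
     [/\ (k <= n)%N, is_group_polynomial k f & A = [set x | f x <> 1]]]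
  = power_inequations n.
Proof.
apply/seteqP; split=> [_ [k [f [kn fP ->]]]|_ [k [c [kn ->]]]].
  have [c [p [q [pq fE]]]] := group_polynomial_normal_form fP.
  have -> : [set x | f x <> 1] = [set x | c * x ^+ p <> 1 * x ^+ q].
    apply/seteqP; split=> x /=; apply: contra_not; rewrite -fE.
      by move=> /mulIg.
    by move=> ->.
  by apply: two_sided_power_inequation; apply: leq_trans kn;
    rewrite -pq ?leq_addr ?leq_addl.
exists k, (fun x => c^-1 * x ^+ k); split=> //.
  exists (fun i => if i == ord0 then c^-1 else 1), (fun=> false) => x /=.
  by under eq_bigr do rewrite mulg1; rewrite prodg_const card_ord.
apply/seteqP; split=> x /=; apply: contra_not.
  by move=> /(congr1 (fun y => c * y)); rewrite mulVKg mulg1.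
by move=> ->; rewrite mulVg.
Qed.

Lemma semigroup_inequationsE n :
  [set A | exists (k l : nat) (f g : G -> G),
     [/\ (k <= n)%N /\ (l <= n)%N, is_semigroup_polynomial k f,
         is_semigroup_polynomial l g & A = [set x | f x <> g x]]]
  = power_inequations n.
Proof.
apply/seteqP; split=> [_ [k [l [f [g [[kn ln] fP gP ->]]]]]|_ [k [c [kn ->]]]].
  have [c fE] := semigroup_polynomial_normal_form fP.
  have [d gE] := semigroup_polynomial_normal_form gP.
  under [X in power_inequations n X]eq_set do rewrite fE gE.
  exact: two_sided_power_inequation.
exists k, 0%N, (fun x => x ^+ k), (fun=> c); split=> //.
  exists (fun=> Some (1 : G)) => // x; rewrite /=.
  elim: k {kn} => [|k IHk]; first by rewrite big_ord0.
  rewrite big_ord_recr mulgA -IHk expgSr; congr Some.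
  by rewrite mulg1.
by exists (fun=> Some c) => // x; rewrite big_ord0 mulg1.
Qed.

Lemma group_zariski_nE n :
  group_zariski_n G n = generated_topology (power_inequations n).
Proof. by rewrite /group_zariski_n group_inequationsE. Qed.

Lemma semigroup_zariski_nE n :
  semigroup_zariski_n G n = generated_topology (power_inequations n).
Proof. by rewrite /semigroup_zariski_n semigroup_inequationsE. Qed.

Lemma group_zariskiE :
  group_zariski G = generated_topology (\bigcup_n power_inequations n).
Proof.
congr generated_topology; apply/seteqP; split=> [_ [k [f [fP ->]]]|A [n _]].
  by exists k => //; rewrite -group_inequationsE; exists k, f.
by rewrite -group_inequationsE => -[k [f [_ fP ->]]]; exists k, f.
Qed.

Lemma semigroup_zariskiE :
  semigroup_zariski G = generated_topology (\bigcup_n power_inequations n).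
Proof.
congr generated_topology; apply/seteqP; split.
  move=> _ [k [l [f [g [fP gP ->]]]]]; exists (maxn k l) => //.
  by rewrite -semigroup_inequationsE; exists k, l, f, g;
    rewrite leq_maxl leq_maxr.
move=> A [n _]; rewrite -semigroup_inequationsE.
by move=> [k [l [f [g [_ fP gP ->]]]]]; exists k, l, f, g.
Qed.

End Commutative.
End PowerInequations.

(** * Additive groups written multiplicatively *)

Section Multiplicative.
Variable V : zmodType.

Definition multiplicative : Type := V.

HB.instance Definition _ := Choice.on multiplicative.
HB.instance Definition _ := @isGroup.Build multiplicative
  0%R (@GRing.opp V) (@GRing.add V)
  (@addrA V) (@add0r V) (@addr0 V) (@addNr V) (@addrN V).

Lemma multiplicativeC (x y : multiplicative) : x * y = y * x.
Proof. exact: addrC. Qed.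

Lemma multiplicative_expg (x : V) n : (x : multiplicative) ^+ n = (x *+ n)%R.
Proof. by elim: n => // n IHn; rewrite expgS IHn mulrS. Qed.

End Multiplicative.

(** * Rational polynomials modulo integral ones *)

Definition integral : {pred {poly rat}} := polyOver_pred (Num.int : {pred rat}).

Fact integral_zmod_closed : zmod_closed integral.
Proof.
split=> [|p q /polyOverP pZ /polyOverP qZ].
  by apply/polyOverP => i; rewrite coef0 rpred0.
by apply/polyOverP => i; rewrite coefB rpredB.
Qed.

HB.instance Definition _ :=
  GRing.isZmodClosed.Build {poly rat} integral integral_zmod_closed.

(** The coefficients of a polynomial taken modulo 1 identify this quotient with
    the direct sum of countably many copies of Q/Z. *)
Definition rat_mod_int_sum : groupType :=
  multiplicative (Quotient.quot integral).

Definition poly_class (p : {poly rat}) : rat_mod_int_sum :=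
  \pi_(Quotient.quot integral)%qT p.

Lemma poly_class_expg_eq (p q : {poly rat}) k :
  (poly_class p ^+ k == poly_class q ^+ k) = ((p - q) *+ k \in integral)%R.
Proof.
by rewrite !multiplicative_expg -!raddfMn mulrnBl -Quotient.idealrBE.
Qed.

Lemma countable_rat_mod_int_sum : countable [set: rat_mod_int_sum].
Proof.
have -> : [set: rat_mod_int_sum] = [set poly_class p | p in setT].
  apply/seteqP; split=> // x _.
  by exists (repr (x : Quotient.quot integral)) => //; rewrite /poly_class reprK.
exact: card_le_trans (card_image_le _ _) (countableP _).
Qed.

Lemma proper_fraction_Nint (k m : nat) :
  (0 < k < m)%N -> (k%:R / m%:R : rat)%R \isn't a Num.int.
Proof.
move=> /andP[k0 km]; apply/negP => /intrP[z zE].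
have m0 : (0 < m%:R :> rat)%R by rewrite ltr0n (leq_ltn_trans _ km).
have : (0 < z%:~R :> rat)%R by rewrite -zE divr_gt0 // ltr0n.
have : (z%:~R < 1 :> rat)%R by rewrite -zE ltr_pdivrMr // mul1r ltr_nat.
by rewrite ltr0z ltrz1; case: z {zE} => [[|z]|z].
Qed.

Definition torsion_seq (m i : nat) : rat_mod_int_sum :=
  poly_class (m%:R^-1 *: 'X^i)%R.

Lemma torsion_seq_expg m i : (0 < m)%N -> torsion_seq m i ^+ m = 1.
Proof.
move=> m0; have class0 : poly_class 0%R = 1 by exact: raddf0.
rewrite -[RHS](expg1n _ m) -class0; apply/eqP.
rewrite poly_class_expg_eq subr0; apply/polyOverP => j.
rewrite coefMn coefZ coefXn -mulrnAl -mulr_natr mulVf ?mul1r ?rpred_nat //.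
by rewrite pnatr_eq0 -lt0n.
Qed.

(** If i <> j, the coefficient of X^i in k (X^i - X^j) / m is k / m, which is
    not an integer. *)
Lemma torsion_seq_expg_inj m k :
  (0 < k < m)%N -> injective (fun i => torsion_seq m i ^+ k).
Proof.
move=> km i j /eqP; rewrite poly_class_expg_eq => /polyOverP/(_ i).
rewrite coefMn coefB !coefZ !coefXn eqxx.
have [//|_] := eqVneq i j; rewrite mulr0 subr0 mulr1 -[(_ *+ k)%R]mulr_natl.
by move=> kmZ; have /negP[] := proper_fraction_Nint km.
Qed.

Lemma rat_mod_int_sum_exponent n : (0 < n)%N ->
  exists x : rat_mod_int_sum, x ^+ n <> 1.
Proof.
move=> n0; exists (torsion_seq n.+1 0 / torsion_seq n.+1 1).
rewrite expgnFl; last exact: multiplicativeC.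
move=> /divg1_eq /torsion_seq_expg_inj; rewrite n0 ltnSn.
by move=> /(_ isT).
Qed.

Lemma zariski_levels_proper n :
  semigroup_zariski_n rat_mod_int_sum n `<`
  semigroup_zariski_n rat_mod_int_sum n.+1.
Proof.
rewrite !(semigroup_zariski_nE (@multiplicativeC _)).
apply: (@generated_topology_power_proper _ _ (torsion_seq n.+1)).
- by move=> i; apply: torsion_seq_expg.
- by move=> k kn; apply: torsion_seq_expg_inj.
- exact: rat_mod_int_sum_exponent.
Qed.

Theorem theorem1p6 :
  exists G : groupType,
    [/\ countable [set: G],
        commutative (fun x y : G => (x * y)%g),
        (forall n m : nat, (n < m)%N ->
           semigroup_zariski_n G n `<` semigroup_zariski_n G m) &
        (forall n : nat,
           [/\ semigroup_zariski G = group_zariski G,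
               group_zariski G <> group_zariski_n G n &
               group_zariski_n G n = semigroup_zariski_n G n])].
Proof.
have mulC := @multiplicativeC (Quotient.quot integral).
exists rat_mod_int_sum; split=> [||n m nm|n].
- exact: countable_rat_mod_int_sum.
- exact: mulC.
- have [sub nsub] := zariski_levels_proper n.
  suff sub' : semigroup_zariski_n rat_mod_int_sum n.+1 `<=`
              semigroup_zariski_n rat_mod_int_sum m.
    by split=> [|/(subset_trans sub')]; first exact: subset_trans sub'.
  rewrite !(semigroup_zariski_nE mulC).
  exact/generated_topologyS/power_inequationsS.
split.
- by rewrite (semigroup_zariskiE mulC) (group_zariskiE mulC).
- rewrite (group_zariskiE mulC) (group_zariski_nE mulC) => E.
  have [_] := zariski_levels_proper n; apply.
  rewrite !(semigroup_zariski_nE mulC) -E.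
  by apply: generated_topologyS => A ?; exists n.+1.
- by rewrite (group_zariski_nE mulC) (semigroup_zariski_nE mulC).
Qed.
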